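(* Let $m\ge 4$, $X=\mathbb{F}_{2^m}\setminus\{0,1\}$, and let $W_2,W_4$ be as in the context. Then the triple $(X,W_2,W_4)$ is a $\mathrm{GDD}(2^m-2,2,4)$ with balance parameter $\lambda_4=\frac{2^m-8}{2}$.
   Context: $\mathbb{F}_{2^m}$ is the finite field with $2^m$ elements, with zero $0$ and unity $1$; all sums are in $\mathbb{F}_{2^m}$. For each integer $k\ge 2$, $W_k=\{B\subset X : |B|=k,\ \sum_{i\in B} i=1,\ \text{and } \binom{B}{\ell}\cap W_\ell=\emptyset \text{ for all } 2\le \ell\le k-3\}$ (recursive definition; $\binom{B}{\ell}$ is the set of $\ell$-subsets of $B$; the last condition is vacuous for $k\le 4$). A group divisible design $\mathrm{GDD}(v,n,k)$ is a triple $(X,\mathcal{G},\mathcal{B})$ where $X$ is a $v$-set, $\mathcal{G}$ is a collection of $n$-subsets of $X$ (groups) and $\mathcal{B}$ is a collection of $k$-subsets of $X$ (blocks), such that (i) $\mathcal{G}$ is a partition of $X$; (ii) no two elements of a block lie together in a common group; (iii) every pair of distinct elements of $X$ from different groups occurs together in exactly $\lambda$ blocks; $\lambda$ is called the balance parameter. *)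

(* Defs.v *)
From HB Require Import structures.
From mathcomp Require Import all_boot all_order all_algebra.

Set Implicit Arguments.
Unset Strict Implicit.
Unset Printing Implicit Defensive.

Import GRing.Theory.
Local Open Scope ring_scope.

Definition X (F : finFieldType) : {set F} := [set: F] :\: [set 0; 1].

(* The family (W_k) is defined by recursion on k.  [W_rec F n k] is W_k
   computed with fuel [n]; each unfolding uses one unit, so [n = k] suffices
   (see [WE] for the resulting defining equation).  The range 2 <= l <= k - 3
   is expressed as l + 3 <= k, which is correct for k < 3 as well. *)
Fixpoint W_rec (F : finFieldType) (n k : nat) : {set {set F}} :=
  if n is n'.+1 then
    [set B : {set F} |
      [&& B \subset X F,
          #|B| == k,
          \sum_(i in B) i == 1 &
          [forall l : 'I_k, (2 <= l)%N ==> (l + 3 <= k)%N ==>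
            [forall C : {set F},
              (C \subset B) ==> (#|C| == l) ==> (C \notin W_rec F n' l)]]]]
  else set0.

Definition W (F : finFieldType) (k : nat) : {set {set F}} := W_rec F k k.

Lemma W_rec_fuel (F : finFieldType) (n n' k : nat) :
  (k <= n)%N -> (k <= n')%N -> (0 < k)%N -> W_rec F n k = W_rec F n' k.
Proof.
elim: n n' k => [|n IHn] [|n'] [|k] //= le_kn le_kn' _.
apply/setP=> B; rewrite !inE; do 3!congr (_ && _).
apply: eq_forallb => l; case: (ltnP 1 l) => //= lt1l; congr (_ ==> _).
apply: eq_forallb => C; rewrite (IHn n' l) //.
- exact: leq_trans (ltn_ord l) le_kn.
- exact: leq_trans (ltn_ord l) le_kn'.
- exact: ltnW.
Qed.

Lemma WE (F : finFieldType) (k : nat) (B : {set F}) : (2 <= k)%N ->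
  B \in W F k <->
  [/\ B \subset X F, #|B| = k, \sum_(i in B) i = 1 &
      forall l, (2 <= l)%N -> (l + 3 <= k)%N ->
        [set C : {set F} | (C \subset B) && (#|C| == l)] :&: W F l = set0].
Proof.
case: k => // k _; rewrite /W [W_rec F k.+1 k.+1]/= inE; split.
- case/and4P=> sBX /eqP cB /eqP sB /forallP H; split=> // l l2 lk.
  have ltlk : (l < k.+1)%N.
    by apply: leq_trans lk; rewrite -addn1 leq_add2l.
  have /= := H (Ordinal ltlk); rewrite l2 lk /= => /forallP HC.
  apply/setP=> C; rewrite !inE; apply/negbTE/negP => /andP[/andP[sCB cC]].
  have := HC C; rewrite sCB cC /=.
  by rewrite (@W_rec_fuel F k l l) // ?(ltnW l2) // => /negP.
- case=> sBX -> sB H; rewrite sBX sB !eqxx /=.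
  apply/forallP=> l; apply/implyP=> l2; apply/implyP=> lk.
  apply/forallP=> C; apply/implyP=> sCB; apply/implyP=> cC.
  rewrite (@W_rec_fuel F k l l) ?(ltnW l2) //; last exact: (ltn_ord l).
  have /setP/(_ C) := H l l2 lk.
  by rewrite !inE sCB cC /= => ->.
Qed.

(* (P, G, B) is a GDD(v, n, k) with balance parameter lam. *)
Record is_GDD (T : finType) (P : {set T}) (G B : {set {set T}})
    (v n k lam : nat) : Prop := IsGDD {
  gdd_points : #|P| = v;
  gdd_groups : forall g, g \in G -> g \subset P /\ #|g| = n;
  gdd_blocks : forall b, b \in B -> b \subset P /\ #|b| = k;
  gdd_partition : partition G P;
  gdd_transverse : forall b g x y, b \in B -> g \in G -> x != y ->
    x \in b -> y \in b -> ~ (x \in g /\ y \in g);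
  gdd_balanced : forall x y g h, x \in P -> y \in P -> x != y ->
    g \in G -> h \in G -> g != h -> x \in g -> y \in h ->
    #|[set b in B | (x \in b) && (y \in b)]| = lam
}.

(* Main.v *)
Require Import Defs.
From HB Require Import structures.
From mathcomp Require Import all_boot all_order all_algebra.
From mathcomp Require Import finfield ring.

(** In characteristic 2 the groups are the pairs [{x, 1 + x}], and a block is
    a 4-subset of [X] with sum [1].  If [x] and [y] lie in different groups,
    the additive span [E] of [1], [x], [y] has 8 elements.  A point [z] lies
    in a block through [x] and [y] other than as [x] or [y] exactly when
    [z \notin E], and that block is then [{x, y, z, 1 + x + y + z}].  Hence
    the complement of [E] is split into pairs by these blocks, so there are
    [(2 ^ m - 8) / 2] of them. *)

Set Implicit Arguments.
Unset Strict Implicit.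
Unset Printing Implicit Defensive.

Import GRing.Theory.
Local Open Scope ring_scope.

Lemma in_X (F : finFieldType) (x : F) : (x \in X F) = (x != 0) && (x != 1).
Proof. by rewrite !inE andbT negb_or. Qed.

Lemma card_X (F : finFieldType) : #|X F| = (#|F| - 2)%N.
Proof.
by rewrite /X setTD cardsCs setCK cards2 eq_sym oner_eq0.
Qed.

(** For [k <= 4] no [l] satisfies both [2 <= l] and [l + 3 <= k], so the recursive condition is
    vacuous. *)
Lemma in_W_small (F : finFieldType) (k : nat) (B : {set F}) :
  (2 <= k <= 4)%N ->
  B \in W F k <-> [/\ B \subset X F, #|B| = k & \sum_(i in B) i = 1].
Proof.
case/andP=> k2 k4; rewrite WE //; split=> [[] //|[sBX cB sB]].
split=> // l l2 lk.
by have := leq_trans (leq_trans (leq_add l2 (leqnn 3)) lk) k4.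
Qed.

(** * Characteristic 2: the groups as pairs *)

Section Char2.

Variable F : finFieldType.
Hypothesis char2F : 2%N \in [pchar F].

Lemma addr_eq_pchar2 (a b c : F) : (a + b == c) = (b == a + c).
Proof. by rewrite -(inj_eq (addrI a)) addKr_pchar2. Qed.

Lemma add1_neq (x : F) : 1 + x != x.
Proof. by rewrite -subr_eq0 addrK oner_eq0. Qed.

Lemma add1_in_X (x : F) : (1 + x \in X F) = (x \in X F).
Proof. by rewrite !in_X !addr_eq_pchar2 addr0 addrr_pchar2 // andbC. Qed.

Lemma W2_pair (x : F) : x \in X F -> [set x; 1 + x] \in W F 2.
Proof.
move=> xX; apply/in_W_small => //; split.
- by apply/subsetP=> z /set2P[] ->; rewrite ?add1_in_X.
- by rewrite cards2 eq_sym add1_neq.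
- rewrite big_setU1 ?inE 1?eq_sym ?add1_neq //= big_set1.
  by rewrite addrCA addrr_pchar2 // addr0.
Qed.

(** In characteristic 2, [a + b = 1] forces [b = 1 + a]. A group is thus determined by any one of
    its points, which gives disjointness of the groups. *)
Lemma W2_eq_pair (g : {set F}) (x : F) :
  g \in W F 2 -> x \in g -> g = [set x; 1 + x].
Proof.
case/in_W_small=> // _ /eqP/cards2P[a [b [ab ->]]].
rewrite big_setU1 ?in_set1 //= big_set1 => /eqP sab /set2P[] ->.
- by move: sab; rewrite addr_eq_pchar2 addrC => /eqP <-.
- by move: sab; rewrite addrC addr_eq_pchar2 addrC setUC => /eqP <-.
Qed.

Lemma W2_partition : partition (W F 2) (X F).
Proof.
apply/and3P; split.
- rewrite eqEsubset; apply/andP; split.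
    by apply/bigcupsP => g /in_W_small[].
  apply/subsetP=> x xX; apply/bigcupP; exists [set x; 1 + x].
    exact: W2_pair.
  exact: set21.
- apply/trivIsetP=> g h gW hW; apply: contraR => /pred0Pn[x /andP[/= xg xh]].
  by rewrite (W2_eq_pair gW xg) (W2_eq_pair hW xh).
- by apply/negP => /in_W_small[] // _; rewrite cards0.
Qed.

(** * Blocks determined by three of their points *)

Definition block (x y z : F) : {set F} :=
  x |: (y |: (z |: [set 1 + x + y + z])).

(** Removing three distinct points leaves a single [w], and the sum condition forces
    [w = 1 + x + y + z]. *)
Lemma W4_block (b : {set F}) (x y z : F) :
  b \in W F 4 -> x \in b -> y \in b -> z \in b ->
  x != y -> z != x -> z != y -> b = block x y z.
Proof.
case/in_W_small=> // _ cb sb xb yb zb xy zx zy.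
have yb' : y \in b :\ x by rewrite !inE eq_sym xy.
have zb' : z \in b :\ x :\ y by rewrite !inE zx zy.
have /cards1P[w bE] : #|b :\ x :\ y :\ z| == 1%N.
  move: cb; rewrite (cardsD1 x) xb (cardsD1 y) yb' (cardsD1 z) zb' !add1n.
  by case=> ->.
move: sb; rewrite (big_setD1 x) //= (big_setD1 y) //= (big_setD1 z) //= bE.
rewrite big_set1 => /eqP; rewrite !addr_eq_pchar2 => /eqP wE.
rewrite -(setD1K xb) -(setD1K yb') -(setD1K zb') bE wE /block.
by congr (_ |: (_ |: (_ |: [set _]))); ring.
Qed.

(** If [y = 1 + x], then for a third point [z] the fourth point [1 + x + y + z] equals [z], and the
    block collapses to at most three elements. *)
Lemma W4_transverse (b g : {set F}) (x y : F) :
  b \in W F 4 -> g \in W F 2 -> x != y ->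
  x \in b -> y \in b -> ~ (x \in g /\ y \in g).
Proof.
move=> bW gW xy xb yb [xg yg].
have y1x : y = 1 + x.
  move: yg; rewrite (W2_eq_pair gW xg) => /set2P[] // yx.
  by rewrite yx eqxx in xy.
have [_ cb _] := (in_W_small b (isT : (2 <= 4 <= 4)%N)).1 bW.
have yb' : y \in b :\ x by rewrite !inE eq_sym xy.
have /card_gt0P[z] : (0 < #|b :\ x :\ y|)%N.
  by move: cb; rewrite (cardsD1 x) xb (cardsD1 y) yb' !add1n; case=> ->.
rewrite !inE => /and3P[zy zx zb].
have := cb; rewrite (W4_block bW xb yb zb xy zx zy) /block y1x addrr_pchar2 //.
rewrite add0r setUid => cE.
have : (#|x |: ((1 + x)%R |: [set z])| <= 3)%N.
  by rewrite !cardsU1 cards1; do 2![case: (_ \notin _)].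
by rewrite cE.
Qed.

(** * Additive spans over the prime field *)

Definition addr2_closed (H : {set F}) := {in H &, forall a b, a + b \in H}.

Definition adjoin (H : {set F}) (x : F) : {set F} :=
  H :|: [set x + a | a in H].

Lemma in_translate (H : {set F}) (x a : F) :
  (a \in [set x + h | h in H]) = (x + a \in H).
Proof.
apply/imsetP/idP=> [[h hH ->]|h]; first by rewrite addKr_pchar2.
by exists (x + a); rewrite // addKr_pchar2.
Qed.

Lemma adjoin_closed (H : {set F}) (x : F) :
  addr2_closed H -> addr2_closed (adjoin H x).
Proof.
move=> HD a b; rewrite !in_setU !in_translate.
case/orP=> aH /orP[] bH; apply/orP.
- by left; apply: HD.
- by right; rewrite addrCA; apply: HD.
- by right; rewrite addrA; apply: HD.
- left; have -> : a + b = (x + a) + (x + b).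
    by rewrite addrACA addrr_pchar2 // add0r.
  exact: HD.
Qed.

(** [H] and its translate by [x] are disjoint: a common element [a] would give [x = (x + a) + a] in
    [H]. *)
Lemma card_adjoin (H : {set F}) (x : F) :
  addr2_closed H -> x \notin H -> #|adjoin H x| = (#|H|).*2.
Proof.
move=> HD xH; rewrite cardsU card_imset; last exact: addrI.
rewrite -addnn [X in (_ - X)%N](_ : _ = 0%N) ?subn0 //.
apply/eqP; rewrite cards_eq0; apply/eqP/setP=> a.
rewrite in_setI in_translate in_set0; apply/negbTE/negP=> /andP[aH xaH].
by move: (HD _ _ xaH aH); rewrite -addrA addrr_pchar2 // addr0 (negbTE xH).
Qed.

Definition span3 (x y : F) : {set F} := adjoin (adjoin [set 0; 1] x) y.

(** * Counting the blocks through two points of different groups *)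

Section Balance.

Variables x y : F.
Hypotheses (xX : x \in X F) (yX : y \in X F).
Hypotheses (xy : x != y) (yNx : y != 1 + x).

Lemma in_span3 z : (z \in span3 x y) =
  [|| z \in [set 0; 1], x + z \in [set 0; 1], y + z \in [set 0; 1]
    | x + (y + z) \in [set 0; 1]].
Proof.
(* [[set 0; 1]] is itself a union; naming it keeps [in_setU] from splitting it. *)
rewrite /span3 /adjoin; set P := [set 0; 1].
by rewrite !(in_setU, in_translate) -!orbA.
Qed.

Lemma F2_closed : addr2_closed [set 0; 1].
Proof.
move=> a b /set2P[] -> /set2P[] ->;
  by rewrite ?add0r ?addr0 ?addrr_pchar2 // !inE eqxx ?orbT.
Qed.

Lemma span3_closed : addr2_closed (span3 x y).
Proof. by do 2!apply: adjoin_closed; exact: F2_closed. Qed.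

Lemma card_span3 : #|span3 x y| = 8%N.
Proof.
move: xX yX; rewrite !in_X => /andP[x0 x1] /andP[y0 y1].
rewrite card_adjoin; first last.
- rewrite in_setU in_translate !inE !addr_eq_pchar2 addr0 (addrC x).
  by rewrite (negbTE y0) (negbTE y1) eq_sym (negbTE xy) (negbTE yNx).
- by apply: adjoin_closed; exact: F2_closed.
rewrite card_adjoin ?cards2 1?eq_sym ?oner_eq0 //; first exact: F2_closed.
by rewrite !inE (negbTE x0) (negbTE x1).
Qed.

(** The span contains [0], [1], [x], [y] and, being closed under addition, misses both [z] and [w].
    This gives every required inequality except [x != y], a hypothesis, and [z != w], which amounts
    to [y != 1 + x]. *)
Lemma block_in_W4 z : z \notin span3 x y -> block x y z \in W F 4.
Proof.
move=> zE; set w := 1 + x + y + z.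
have [E0 E1 Ex Ey] :
    [/\ 0 \in span3 x y, 1 \in span3 x y, x \in span3 x y & y \in span3 x y].
  by split; rewrite in_span3 ?(addrr_pchar2 char2F) !inE eqxx ?orbT.
have wE : w \notin span3 x y.
  apply: contra zE => wE.
  have -> : z = (1 + x + y) + w by rewrite /w addKr_pchar2.
  by apply: span3_closed => //; do 2?[apply: span3_closed => //].
have notE e u : e \in span3 x y -> u \notin span3 x y -> e != u.
  by move=> eE; apply: contraNneq => <-.
have sX u : u \notin span3 x y -> u \in X F.
  by move=> uE; rewrite in_X ![u == _]eq_sym !notE.
have zw : z != w.
  rewrite /w -subr_eq0 opprD addrCA subrr addr0 oppr_eq0.
  by rewrite addr_eq_pchar2 addr0.
have zNw : z \notin [set w] by rewrite inE.
have yN : y \notin z |: [set w] by rewrite !inE negb_or !notE.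
have xN : x \notin y |: (z |: [set w]) by rewrite !inE !negb_or xy !notE.
apply/in_W_small => //; split.
- by rewrite !subUset !sub1set xX yX !sX.
- by rewrite !cardsU1 xN yN zNw cards1.
- rewrite !big_setU1 //= big_set1 /w.
  have -> : x + (y + (z + (1 + x + y + z))) = (x + y + z) + (x + y + z) + 1.
    by ring.
  by rewrite addrr_pchar2 // add0r.
Qed.

(** Each of the eight values in the span is ruled out for [z]: [0] and [1] lie outside [X], [x] and
    [y] are excluded by hypothesis, and [x + 1], [y + 1], [x + y], [x + y + 1] would make the fourth
    point [w] equal to [y], [x], [1], [0] respectively. *)
Lemma W4_notin_span3 b z : b \in W F 4 -> x \in b -> y \in b -> z \in b ->
  z != x -> z != y -> z \notin span3 x y.
Proof.
move=> bW xb yb zb zx zy; have bE := W4_block bW xb yb zb xy zx zy.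
have [/subsetP sbX cb _] := (in_W_small b (isT : (2 <= 4 <= 4)%N)).1 bW.
have := sbX _ zb; rewrite in_X => /andP[z0 z1].
set w := 1 + x + y + z in bE.
have wb : w \in b by rewrite bE !inE eqxx !orbT.
have := sbX _ wb; rewrite in_X => /andP[w0 w1].
have [wx wy] : w != x /\ w != y.
  (* If [w] were [x] or [y], the block would have at most three elements. *)
  suff /norP[] : ~~ ((w == x) || (w == y)) by [].
  apply/negP=> wxy; have := cb; rewrite bE /block -/w.
  have -> : x |: (y |: (z |: [set w])) = x |: (y |: [set z]).
    apply/setP=> u; rewrite !inE; case: (u =P w) => [->|_]; last by rewrite orbF.
    by case/orP: wxy => ->; rewrite ?orbT.
  by rewrite !cardsU1 cards1; do 2![case: (_ \notin _)].
have wE : w = 1 + (x + (y + z)) by rewrite /w !addrA.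
rewrite in_span3 !inE !negb_or z0 z1 !addr_eq_pchar2 !addr0 zx zy /=.
apply/and4P; split.
- apply: contra wy => /eqP zE; rewrite wE zE.
  have -> : 1 + (x + (y + (x + 1))) = (1 + x) + (1 + x) + y by ring.
  by rewrite addrr_pchar2 // add0r.
- apply: contra wx => /eqP zE; rewrite wE zE.
  have -> : 1 + (x + (y + (y + 1))) = (1 + y) + (1 + y) + x by ring.
  by rewrite addrr_pchar2 // add0r.
- apply: contra w1 => /eqP zE; rewrite wE zE.
  by rewrite addKr_pchar2 // addrr_pchar2 // addr0.
- apply: contra w0 => /eqP zE; rewrite wE zE.
  by rewrite !addKr_pchar2 // addrr_pchar2.
Qed.

Lemma card_W4_pair :
  #|[set b in W F 4 | (x \in b) && (y \in b)]| = ((#|F| - 8) %/ 2)%N.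
Proof.
set Bs := [set b in _ | _].
suff -> : (#|F| - 8 = #|Bs| * 2)%N by rewrite mulnK.
rewrite -card_span3 -[span3 x y]setCK -cardsCs -[LHS]sum1_card -sum_nat_const.
(* The complement of the span is fibred over the blocks by [block x y]; the fibre over [b] is [b]
   without [x] and [y], of size 2. *)
rewrite (partition_big (block x y) (mem Bs)) => [|z]; last first.
  rewrite in_setC => zE; rewrite 2!inE block_in_W4 //.
  by rewrite !inE !eqxx ?orbT.
apply: eq_bigr => b /setIdP[bW /andP[xb yb]].
have [_ cb _] := (in_W_small b (isT : (2 <= 4 <= 4)%N)).1 bW.
have yb' : y \in b :\ x by rewrite !inE eq_sym xy.
have c2 : #|b :\ x :\ y| = 2%N.
  by move: cb; rewrite (cardsD1 x) xb (cardsD1 y) yb' !add1n; case.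
rewrite -{}c2 -sum1_card; apply: eq_bigl => z.
rewrite in_setC !in_setD1.
apply/andP/and3P => [[zE /eqP bE]|[zy zx zb]]; last first.
  by rewrite (W4_notin_span3 bW xb yb zb zx zy)
    -(W4_block bW xb yb zb xy zx zy).
split; last by rewrite -bE !inE eqxx !orbT.
all: apply: contraNneq zE => ->.
all: by rewrite in_span3 addrr_pchar2 // !inE eqxx !orbT.
Qed.

End Balance.

End Char2.

Theorem theorem3p13 (F : finFieldType) (m : nat) (hm : (4 <= m)%N)
  (cardF : #|F| = (2 ^ m)%N) :
  is_GDD (X F) (W F 2) (W F 4) (2 ^ m - 2) 2 4 ((2 ^ m - 8) %/ 2).
Proof.
have char2F : 2%N \in [pchar F] by apply: (card_finPcharP cardF).
split.
- by rewrite card_X cardF.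
- by move=> g /in_W_small[].
- by move=> b /in_W_small[].
- exact: W2_partition.
- exact: W4_transverse.
- move=> x y g h xX yX xy gW hW gh xg yh.
  (* What remains is [y != 1 + x]: equality would make the two groups the same pair. *)
  rewrite card_W4_pair ?cardF //; apply: contraNneq gh => yE.
  rewrite (W2_eq_pair char2F gW xg) (W2_eq_pair char2F hW yh) yE.
  by rewrite addKr_pchar2 // setUC.
Qed.
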